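(* Let $K$ be a field of characteristic $0$ and let $n$ be an integer with $1 \leq n \leq 4$. Let $V = K^n$ be the natural representation of the symmetric group $S_n$, and let $S_n$ act diagonally on $V^2 = V \times V$. Let \[ I = \{ (j,k) \in \mathbb{N}^2 \mid 0 \leq j \leq n,\ 0 \leq k \leq \lfloor \tfrac{n}{j+1} \rfloor,\ (j,k) \neq (0,0) \}, \] let $f_{j,k} = \sum_{i=1}^n x_i^j y_i^k$, and let $S = \{ f_{j,k} \mid (j,k) \in I \}$. Then $S$ is a minimal separating subset of $K[V^2]^{S_n}$ with respect to inclusion; that is, $S$ is separating and no proper subset of $S$ is separating.
   Context: Here $\mathbb{N}$ includes $0$. The coordinate ring is $K[V^2] = K[x_1,\ldots,x_n,y_1,\ldots,y_n]$, where $x_1,\ldots,x_n$ are the coordinates on the first copy of $V$ and $y_1,\ldots,y_n$ those on the second copy. The group $S_n$ acts on $V^2 = K^n \times K^n$ by permuting the $n$ coordinates of both copies simultaneously, and $K[V^2]^{S_n}$ is the ring of polynomials invariant under the induced simultaneous permutation of the $x_i$ and the $y_i$. A subset $T \subseteq K[V^2]^{S_n}$ is called separating if for all points $p,q \in V^2$: whenever there is an invariant $f \in K[V^2]^{S_n}$ with $f(p) \neq f(q)$, there is an element $g \in T$ with $g(p) \neq g(q)$. (Since $S_n$ is finite, this is equivalent to: if $g(p)=g(q)$ for all $g \in T$, then $p$ and $q$ lie in the same $S_n$-orbit.) *)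

(* Defs.v *)
From HB Require Import structures.
From mathcomp Require Import all_boot all_order all_fingroup all_algebra.
From mathcomp Require Import mpoly.

Set Implicit Arguments.
Unset Strict Implicit.
Unset Printing Implicit Defensive.

Import GRing.Theory.
Local Open Scope ring_scope.

(* The coordinate ring K[x_1..x_n, y_1..y_n] of V^2 = K^n x K^n is
   {mpoly K[n + n]}: the first n variables are the x_i, the last n the y_i. *)
Definition xvar (K : fieldType) (n : nat) (i : 'I_n) : {mpoly K[n + n]} :=
  'X_(lshift n i).

Definition yvar (K : fieldType) (n : nat) (i : 'I_n) : {mpoly K[n + n]} :=
  'X_(rshift n i).

Definition evalV2 (K : fieldType) (n : nat) (f : {mpoly K[n + n]})
    (p : 'rV[K]_n * 'rV[K]_n) : K :=
  f.@[row_mx p.1 p.2 0].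

Definition diag_fun (n : nat) (s : 'S_n) (i : 'I_(n + n)) : 'I_(n + n) :=
  match split i with
  | inl j => lshift n (s j)
  | inr j => rshift n (s j)
  end.

Lemma diag_fun_inj (n : nat) (s : 'S_n) : injective (diag_fun s).
Proof.
apply: (can_inj (g := diag_fun s^-1%g)) => i; rewrite /diag_fun -[RHS]splitK.
case: (split i) => j; first by rewrite (unsplitK (inl (s j))) permK.
by rewrite (unsplitK (inr (s j))) permK.
Qed.

Definition diag_perm (n : nat) (s : 'S_n) : 'S_(n + n) :=
  perm (@diag_fun_inj n s).

(* [msym t f] replaces each variable 'X_i of f by 'X_(t i). *)
Definition diag_invariant (K : fieldType) (n : nat)
    (f : {mpoly K[n + n]}) : Prop :=
  forall s : 'S_n, msym (diag_perm s) f = f.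

Definition separating (K : fieldType) (n : nat)
    (T : {mpoly K[n + n]} -> Prop) : Prop :=
  (forall f, T f -> diag_invariant f) /\
  (forall p q : 'rV[K]_n * 'rV[K]_n,
     (exists2 f, diag_invariant f & evalV2 f p <> evalV2 f q) ->
     exists2 g, T g & evalV2 g p <> evalV2 g q).

Definition proper_subset (A : Type) (T S : A -> Prop) : Prop :=
  (forall f, T f -> S f) /\ (exists2 f, S f & ~ T f).

Definition minimal_separating (K : fieldType) (n : nat)
    (S : {mpoly K[n + n]} -> Prop) : Prop :=
  separating S /\
  (forall T : {mpoly K[n + n]} -> Prop, proper_subset T S -> ~ separating T).

Definition indexI (n : nat) (jk : nat * nat) : bool :=
  [&& (jk.1 <= n)%N, (jk.2 <= n %/ jk.1.+1)%N & jk != (0%N, 0%N)].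

Definition fpoly (K : fieldType) (n j k : nat) : {mpoly K[n + n]} :=
  \sum_(i < n) xvar K i ^+ j * yvar K i ^+ k.

Definition setS (K : fieldType) (n : nat) (f : {mpoly K[n + n]}) : Prop :=
  exists2 jk : nat * nat, indexI n jk & f = fpoly K n jk.1 jk.2.

(* Main.v *)
Require Import Defs.
From mathcomp Require Import all_boot all_order all_fingroup all_algebra.
From mathcomp Require Import mpoly ssrZ.

Set Implicit Arguments.
Unset Strict Implicit.
Unset Printing Implicit Defensive.

Import GRing.Theory.
Local Open Scope ring_scope.

Local Notation Z := BinNums.Z.

(** A point of V^2 is read as the list of the n pairs (x_i, y_i); its S_n-orbit
    is then the multiset of these pairs, and f_{j,k} is their moment of bidegree
    (j,k).

    Separation holds for every n.  Suppose that two lists of n pairs have the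
    same moments for all (j,k) in I.  The moments (j,0) with 1 <= j <= n
    determine the multiset of the x_i ([perm_eq_power_sums]), so both lists have
    the same values a of x, with the same multiplicities.  It remains to see that
    over each value a the fibers, that is the multisets of the y_i with x_i = a,
    agree; for this it is enough that they have equal k-th power sums for all
    k up to their size.  This is shown by induction on k.  Fibers with fewer than
    k elements already agree, so they contribute equally to both lists.  There
    are r fibers with at least k elements, and r * k <= n.  Hence the moments
    (j,k) with j < r all lie in I: k <= n / (j + 1) is exactly k * (j + 1) <= n.
    They give r linear equations on the r differences of k-th power sums, with a
    Vandermonde matrix, so these differences vanish ([perm_eq_bimoments]).

    For minimality, for each (j,k) in I a pair of points with integer coordinates
    is given ([witness]) on which f_{j,k} differs while all other elements of S
    agree; hence a separating subset of S contains every f_{j,k}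
    ([minimal_separatingP]).  In characteristic 0 equalities and inequalities
    between integers are preserved in K, so a finite computation on integers
    suffices, for each n <= 4. *)

(** * Power sums determine a multiset in characteristic 0 *)

Lemma newton_step (A : comPzRingType) (x c l g q d w N : A) :
  l * g = x - c -> q * N = x * d - w ->
  l * q * (g + N) = x * (1 * q + l * d) - (c * q + l * w).
Proof.
move=> lg qN; rewrite mulrDr mulrAC lg -mulrA qN.
by rewrite mul1r mulrBl mulrBr mulrDr opprD addrACA (mulrCA l).
Qed.

(** Newton's identities in one equation.  For each entry a of s
    and Q = \prod_a (X - a), (X^(m+1) - a^(m+1)) / (X - a) is the sum of the
    a^k X^(m-k) for k <= m; multiplying by Q and summing over a gives the
    equation with W = \sum_a a^(m+1) Q / (X - a), of which only the degree
    matters below. *)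
Lemma newton_identity (R : comNzRingType) (m : nat) (s : seq R) :
  exists2 W : {poly R}, (size W <= size s)%N &
  (\prod_(a <- s) ('X - a%:P)) *
    (\sum_(k < m.+1) (\sum_(a <- s) a ^+ k)%:P * 'X^(m - k)) =
  'X^(m.+1) * (\prod_(a <- s) ('X - a%:P))^`() - W.
Proof.
elim: s => [|a s [W sW IH]].
  exists 0; first by rewrite size_poly0.
  rewrite !big_nil derivE mulr0 subr0 big1 ?mulr0 // => k _.
  by rewrite big_nil mul0r.
set Q := \prod_(b <- s) _ in IH *.
exists ((a ^+ m.+1)%:P * Q + ('X - a%:P) * W).
  rewrite (leq_trans (size_polyD _ _)) // geq_max; apply/andP; split.
    rewrite mul_polyC (leq_trans (size_scale_leq _ _)) //.
    by rewrite size_prod_XsubC.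
  by rewrite (leq_trans (size_polyMleq _ _)) // size_XsubC.
have geom : ('X - a%:P) * (\sum_(k < m.+1) (a ^+ k)%:P * 'X^(m - k)) =
    'X^(m.+1) - (a ^+ m.+1)%:P.
  rewrite rmorphXn subrXX; congr (_ * _); apply: eq_bigr => k _.
  by rewrite mulrC rmorphXn.
have -> : \sum_(k < m.+1) (\sum_(b <- a :: s) b ^+ k)%:P * 'X^(m - k) =
   \sum_(k < m.+1) (a ^+ k)%:P * 'X^(m - k) +
   \sum_(k < m.+1) (\sum_(b <- s) b ^+ k)%:P * 'X^(m - k).
  rewrite -big_split; apply: eq_bigr => k _.
  by rewrite big_cons polyCD mulrDl.
rewrite big_cons -/Q derivM derivXsubC.
exact: newton_step geom IH.
Qed.

Lemma power_sum0 (R : pzRingType) (s : seq R) :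
  \sum_(a <- s) a ^+ 0 = (size s)%:R.
Proof.
rewrite (eq_bigr (fun=> 1)) => [|a _]; last by rewrite expr0.
by rewrite big_const_seq count_predT iter_addr_0.
Qed.

(** Let D be the difference of the monic polynomials Qs and Qt whose roots are s
    and t.  Subtracting the identities of [newton_identity] for s and t, which
    share the same factor N, leaves D * N = X^(m+1) * D' - (Ws - Wt).  If D were
    nonzero, of degree d < m, then comparing the coefficients of X^(m+d) would
    give m * lead(D) = d * lead(D), which is absurd in characteristic 0. *)
Lemma perm_eq_power_sums (K : fieldType) (s t : seq K) :
  [pchar K] =i pred0 -> size s = size t ->
  (forall k, (0 < k <= size s)%N ->
     \sum_(a <- s) a ^+ k = \sum_(a <- t) a ^+ k) ->
  perm_eq s t.
Proof.
move=> /pcharf0P charK0 eq_st eq_pow; apply: prod_XsubC_eq.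
set m := size s; pose N (r : seq K) : {poly K} :=
  \sum_(k < m.+1) (\sum_(a <- r) a ^+ k)%:P * 'X^(m - k).
(* The zeroth power sums agree because the lists have the same size. *)
have N_st : N s = N t.
  apply: eq_bigr => -[[|k] lt_km] _; last by rewrite eq_pow.
  by rewrite !power_sum0 eq_st.
have N_top : (N s)`_m = m%:R.
  rewrite coef_sum big_ord_recl [X in _ + X]big1 => [|k _].
    by rewrite power_sum0 subn0 coefCM coefXn eqxx mulr1 addr0.
  rewrite coefCM coefXn gtn_eqF ?mulr0 // ltn_subrL /=.
  by rewrite (leq_ltn_trans _ (ltn_ord k)).
have szN : (size (N s) <= m.+1)%N.
  apply: (leq_trans (size_sum _ _ _)); apply/bigmax_leqP => k _.
  rewrite mul_polyC (leq_trans (size_scale_leq _ _)) // size_polyXn.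
  by rewrite ltnS leq_subr.
have [Ws sWs] := newton_identity m s; have [Wt sWt] := newton_identity m t.
rewrite -/(N s) -/(N t) -N_st => eqt eqs.
set Qs := \prod_(a <- s) _ in eqs *; set Qt := \prod_(a <- t) _ in eqt *.
apply/eqP; rewrite -subr_eq0; set D := Qs - Qt; apply/negPn/negP => D_neq0.
have eqD : D * N s = 'X^(m.+1) * D^`() - (Ws - Wt).
  rewrite mulrBl eqs eqt derivB mulrBr !opprB.
  by rewrite [Wt - 'X^_ * _]addrC addrACA [- Ws + _]addrC.
have [d szD] : {d | size D = d.+1}.
  by exists (size D).-1; rewrite prednK // size_poly_gt0.
(* Both polynomials are monic of degree m, so their leading terms cancel. *)
have lt_dm : (d < m)%N.
  rewrite -szD.
  have Q_top (r : seq K) j : size r = m -> (m <= j)%N ->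
      (\prod_(a <- r) ('X - a%:P))`_j = (j == m)%:R.
    move=> sz_r; rewrite leq_eqVlt => /predU1P[<-|lt_mj].
      rewrite eqxx -[RHS](lead_coef_prod_XsubC r predT id) /lead_coef.
      by rewrite size_prod_XsubC sz_r.
    by rewrite nth_default ?gtn_eqF // size_prod_XsubC sz_r.
  by apply/leq_sizeP => j le_mj; rewrite coefB !Q_top ?subrr -?eq_st.
have m_neq0 : m%:R != 0 :> K by rewrite charK0 -lt0n (leq_ltn_trans _ lt_dm).
have {}szN : size (N s) = m.+1.
  apply/anti_leq; rewrite szN /= ltnNge; apply: contra m_neq0 => le_Nm.
  by rewrite -N_top nth_default.
have N_neq0 : N s != 0 by rewrite -size_poly_gt0 szN.
have top_l : (D * N s)`_(m + d) = D`_d *+ m.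
  rewrite -mulr_natr -N_top; have := lead_coefM D (N s).
  rewrite /lead_coef size_mul // szN szD.
  by rewrite addnS addSn /= addnC.
have top_r : ('X^(m.+1) * D^`())`_(m + d) = D`_d *+ d.
  rewrite coefXnM ltnS; case: d szD {lt_dm top_l} => [|d] szD.
    by rewrite addn0 leqnn mulr0n.
  by rewrite addnS ltnNge leq_addr subSS addKn coef_deriv.
have W_top : (Ws - Wt)`_(m + d) = 0.
  rewrite coefB !nth_default ?subrr // (leq_trans _ (leq_addr d m)) //.
  by rewrite /m eq_st.
have := congr1 (fun p : {poly K} => p`_(m + d)) eqD.
rewrite coefB top_l top_r W_top subr0 => /eqP.
rewrite -subr_eq0 -mulrnBr 1?ltnW //.
rewrite -mulr_natr mulf_eq0 charK0 subn_eq0 leqNgt lt_dm orbF.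
have -> : D`_d = lead_coef D by rewrite /lead_coef szD.
by rewrite lead_coef_eq0 (negPf D_neq0).
Qed.

(** * Separation of finite multisets of pairs *)

(** The Vandermonde matrix is invertible: the hypothesis extends by linearity from
    monomials to all polynomials of degree less than [size A], and it is applied
    to the one that vanishes at all points of [A] but a. *)
Lemma vandermonde_free (K : fieldType) (A : seq K) (c : K -> K) :
  uniq A ->
  (forall j, (j < size A)%N -> \sum_(a <- A) a ^+ j * c a = 0) ->
  forall a, a \in A -> c a = 0.
Proof.
move=> uA c0 a aA.
pose g := \prod_(b <- rem a A) ('X - b%:P).
have szg : size g = size A.
  rewrite size_prod_XsubC size_rem // prednK // -has_predT.
  by apply/hasP; exists a.
have : \sum_(b <- A) g.[b] * c b = 0.
  under eq_bigr do rewrite horner_coef mulr_suml.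
  rewrite exchange_big big1 // => j _ /=.
  under eq_bigr do rewrite -mulrA.
  by rewrite -mulr_sumr c0 ?mulr0 // -szg.
rewrite (bigD1_seq a) //= big_seq_cond big1 ?addr0 => [/eqP|b /andP[bA ba]].
  rewrite mulf_eq0 -/(root g a) root_prod_XsubC mem_rem_uniq // !inE eqxx.
  by move/eqP.
by rewrite (rootP _) ?mul0r // root_prod_XsubC mem_rem_uniq // !inE ba.
Qed.

Definition bimoment (R : pzSemiRingType) (s : seq (R * R)) (j k : nat) : R :=
  \sum_(z <- s) z.1 ^+ j * z.2 ^+ k.

Definition fiber (T : eqType) (s : seq (T * T)) (a : T) : seq T :=
  [seq z.2 | z <- s & z.1 == a].

Lemma count_mem_fiber (T : eqType) (s : seq (T * T)) (z : T * T) :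
  count_mem z s = count_mem z.2 (fiber s z.1).
Proof.
rewrite count_map count_filter; apply: eq_count => -[x y] /=.
by rewrite [LHS]xpair_eqE andbC.
Qed.

Lemma size_fiber (T : eqType) (s : seq (T * T)) (a : T) :
  size (fiber s a) = count_mem a [seq z.1 | z <- s].
Proof. by rewrite size_map size_filter count_map. Qed.

Lemma big_fiber (R : Type) (idx : R) (op : Monoid.com_law idx) (T : Type)
    (U : eqType) (A : seq U) (s : seq T) (p : T -> U) (F : T -> R) :
  uniq A -> all (fun z => p z \in A) s ->
  \big[op/idx]_(a <- A) \big[op/idx]_(z <- s | p z == a) F z =
  \big[op/idx]_(z <- s) F z.
Proof.
move=> uA; elim: s => [|z s IH] /=.
  by rewrite big_nil big1 // => a _; rewrite big_nil.
case/andP=> zA /IH{}IH; rewrite big_cons -IH.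
under eq_bigr => a _ do rewrite big_cons.
rewrite (bigD1_seq (p z)) //= eqxx [in RHS](bigD1_seq (p z)) //= Monoid.mulmA.
congr (op _ _); apply: eq_bigr => a.
by rewrite eq_sym => /negPf->.
Qed.

Lemma bimoment_fibers (R : comPzSemiRingType) (A : seq R) (s : seq (R * R))
    (j k : nat) :
  uniq A -> {subset [seq z.1 | z <- s] <= A} ->
  bimoment s j k = \sum_(a <- A) a ^+ j * \sum_(y <- fiber s a) y ^+ k.
Proof.
move=> uA sA; rewrite /bimoment -(big_fiber _ (p := fst) _ uA); last first.
  by apply/allP => z zs; apply/sA/map_f.
apply: eq_bigr => a _; rewrite big_map big_filter mulr_sumr.
by apply: eq_bigr => z /eqP->.
Qed.

Lemma sum_size_fibers (T : eqType) (s : seq (T * T)) (P : pred T) :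
  (\sum_(a <- undup [seq z.1 | z <- s] | P a) size (fiber s a) <= size s)%N.
Proof.
have uA := undup_uniq [seq z.1 | z <- s].
rewrite -[X in (_ <= X)%N]sum1_size -(big_fiber _ (p := fst) _ uA).
  rewrite big_mkcond; apply: leq_sum => a _.
  by case: (P a) => //; rewrite size_map size_filter sum1_count.
by apply/allP => z zs; rewrite mem_undup map_f.
Qed.

(** The moments (j,0) give the multiset of first coordinates.  The fibers are then
    compared by induction on k: the r fibers with at least k elements satisfy
    r * k <= n, so the r equations of bidegree (j,k), j < r, are available. *)
Lemma perm_eq_bimoments (K : fieldType) (s t : seq (K * K)) :
  [pchar K] =i pred0 -> size s = size t ->
  (forall j k, indexI (size s) (j, k) -> bimoment s j k = bimoment t j k) ->
  perm_eq s t.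
Proof.
move=> charK0 eq_st eq_mom.
have perm_fst : perm_eq [seq z.1 | z <- s] [seq z.1 | z <- t].
  apply: (perm_eq_power_sums charK0); rewrite !size_map // => j /andP[j0 le_js].
  have := eq_mom j 0%N.
  rewrite /indexI /= le_js xpair_eqE andbT -lt0n j0 => /(_ isT).
  rewrite !big_map; congr (_ = _); apply: eq_bigr => z _;
    by rewrite expr0 mulr1.
have eq_size a : size (fiber s a) = size (fiber t a).
  by rewrite !size_fiber (seq.permP perm_fst).
set A := undup [seq z.1 | z <- s].
have uA : uniq A by apply: undup_uniq.
have sA : {subset [seq z.1 | z <- s] <= A} by move=> a; rewrite mem_undup.
have tA : {subset [seq z.1 | z <- t] <= A}.
  by move=> a; rewrite -(perm_mem perm_fst) => /sA.
(* Strong induction on k, simultaneously for all fibers. *)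
have eq_pow k a : (0 < k <= size (fiber s a))%N ->
    \sum_(y <- fiber s a) y ^+ k = \sum_(y <- fiber t a) y ^+ k.
  elim/ltn_ind: k a => k IH a /andP[k_gt0 le_ka].
  pose c b := \sum_(y <- fiber s b) y ^+ k - \sum_(y <- fiber t b) y ^+ k.
  pose B := [seq b <- A | k <= size (fiber s b)]%N.
  (* A fiber with fewer than k elements is already determined by the power sums
     of exponent below k. *)
  have c_small b : ~~ (k <= size (fiber s b))%N -> c b = 0.
    rewrite -ltnNge => lt_bk; apply/eqP; rewrite subr_eq0; apply/eqP.
    apply/perm_big/(perm_eq_power_sums charK0 (eq_size b)) => i /andP[i0 le_i].
    by apply: IH; rewrite ?i0 // (leq_ltn_trans le_i).
  apply: subr0_eq; apply: (vandermonde_free (A := B) (c := c)).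
  - exact: filter_uniq.
  - move=> j lt_jB; have le_Bk : (size B * k <= size s)%N.
      apply: leq_trans (sum_size_fibers s (fun b => k <= size (fiber s b))%N).
      rewrite -sum1_size big_distrl /= big_filter.
      by apply: leq_sum => b; rewrite mul1n.
    have jkI : indexI (size s) (j, k).
      have le_jk : (k * j.+1 <= size s)%N.
        by rewrite mulnC (leq_trans _ le_Bk) // leq_mul2r lt_jB orbT.
      rewrite /indexI /= xpair_eqE leq_divRL // le_jk (gtn_eqF k_gt0).
      rewrite andbF andbT.
      by rewrite (leq_trans (leqnSn j)) // (leq_trans _ le_jk) // leq_pmull.
    rewrite big_filter big_mkcond -[RHS](subrr (bimoment s j k)).
    rewrite [X in _ - X]eq_mom // (bimoment_fibers _ _ uA sA).
    rewrite (bimoment_fibers _ _ uA tA) -sumrB.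
    apply: eq_bigr => b _; rewrite -mulrBr -/(c b).
    by case: ifPn => // /c_small->; rewrite mulr0.
  rewrite mem_filter le_ka mem_undup -has_pred1 has_count -size_fiber.
  exact: leq_trans le_ka.
apply/allP => z _; apply/eqP; rewrite /= !count_mem_fiber; apply/seq.permP.
by apply: (perm_eq_power_sums charK0) => // k; apply: eq_pow.
Qed.

(** * Points of V^2 and invariant polynomials *)

Definition points (K : fieldType) (n : nat) (p : 'rV[K]_n * 'rV[K]_n) :
    n.-tuple (K * K) :=
  [tuple (p.1 0 i, p.2 0 i) | i < n].

Lemma evalV2_fpoly (K : fieldType) (n j k : nat) (p : 'rV[K]_n * 'rV[K]_n) :
  evalV2 (fpoly K n j k) p = bimoment (points p) j k.
Proof.
rewrite /evalV2 /fpoly /bimoment raddf_sum big_tuple /=.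
apply: eq_bigr => i _.
rewrite rmorphM !rmorphXn /= !mevalXU row_mxEl row_mxEr.
by rewrite tnth_mktuple.
Qed.

Lemma meval_msym (R : comNzRingType) (n : nat) (s : 'S_n) (f : {mpoly R[n]})
    (v : 'I_n -> R) :
  (msym s f).@[v] = f.@[v \o s].
Proof.
rewrite [f]mpolyE (raddf_sum (msym s)) (raddf_sum (meval v)).
rewrite (raddf_sum (meval (v \o s))) /=; apply: eq_bigr => m _.
rewrite msymZ !mevalZ msymX !mevalX; congr (_ * _).
rewrite (reindex_perm s) /=; apply: eq_bigr => i _.
by rewrite mnmE permK.
Qed.

Lemma diag_perm_lshift (n : nat) (s : 'S_n) (i : 'I_n) :
  diag_perm s (lshift n i) = lshift n (s i).
Proof. by rewrite permE /diag_fun (unsplitK (inl i)). Qed.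

Lemma diag_perm_rshift (n : nat) (s : 'S_n) (i : 'I_n) :
  diag_perm s (rshift n i) = rshift n (s i).
Proof. by rewrite permE /diag_fun (unsplitK (inr i)). Qed.

Lemma evalV2_perm (K : fieldType) (n : nat) (f : {mpoly K[n + n]})
    (p q : 'rV[K]_n * 'rV[K]_n) :
  diag_invariant f -> perm_eq (points q) (points p) -> evalV2 f p = evalV2 f q.
Proof.
move=> inv_f /tuple_permP[s /val_inj eq_qp].
rewrite /evalV2 -{1}(inv_f s) meval_msym; apply: meval_eq => i /=.
have eq_i j : (q.1 0 j = p.1 0 (s j)) * (q.2 0 j = p.2 0 (s j)).
  have := congr1 (fun u => tnth u j) eq_qp.
  by rewrite /= !tnth_mktuple => -[-> ->].
rewrite -[i]splitK; case: (split i) => j /=.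
  by rewrite diag_perm_lshift !row_mxEl eq_i.
by rewrite diag_perm_rshift !row_mxEr eq_i.
Qed.

Lemma msymXU (R : comNzRingType) (n : nat) (s : 'S_n) (i : 'I_n) :
  msym s 'X_i = 'X_(s i) :> {mpoly R[n]}.
Proof.
rewrite msymX; congr 'X_[_]; apply/mnmP => j; rewrite mnmE !mnm1E.
by congr (nat_of_bool _); apply/eqP/eqP => [->|<-]; rewrite ?permKV ?permK.
Qed.

Lemma fpoly_invariant (K : fieldType) (n j k : nat) :
  diag_invariant (fpoly K n j k).
Proof.
move=> s; rewrite /fpoly (raddf_sum (msym _)) [RHS](reindex_perm s) /=.
apply: eq_bigr => i _; rewrite rmorphM !rmorphXn /= /xvar /yvar.
by rewrite !msymXU diag_perm_lshift diag_perm_rshift.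
Qed.

Lemma indexI_mem (n : nat) (jk : nat * nat) :
  indexI n jk -> jk \in [seq (j, k) | j <- iota 0 n.+1, k <- iota 0 n.+1].
Proof.
case: jk => j k /and3P[le_j le_k _]; apply/allpairsPdep.
exists j, k; rewrite !mem_iota !add0n !ltnS; split=> //.
exact: leq_trans le_k (leq_div _ _).
Qed.

(** The finite list of candidate indices makes the search for a separating element
    of S decidable. *)
Lemma setS_separating (K : fieldType) (n : nat) :
  [pchar K] =i pred0 -> separating (@setS K n).
Proof.
move=> charK0; split=> [_ [jk _ ->]|p q [f inv_f neq_f]].
  exact: fpoly_invariant.
have [|/hasPn all_eq] := boolP (has (fun jk : nat * nat => indexI n jk &&
  (evalV2 (fpoly K n jk.1 jk.2) p != evalV2 (fpoly K n jk.1 jk.2) q))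
  [seq (j, k) | j <- iota 0 n.+1, k <- iota 0 n.+1]).
  case/hasP=> jk _ /andP[jkI /eqP neq_jk].
  by exists (fpoly K n jk.1 jk.2) => //; exists jk.
case: neq_f; apply: evalV2_perm => //; rewrite perm_sym.
apply: perm_eq_bimoments => // [|j k]; rewrite !size_tuple // => jkI.
have := all_eq _ (indexI_mem jkI); rewrite jkI negbK => /eqP.
by rewrite !evalV2_fpoly.
Qed.

(** * Minimality *)

(** If f_{j,k} is missing from T, then T does not distinguish p from q, although
    the invariant f_{j,k} does. *)
Lemma minimal_separatingP (K : fieldType) (n : nat) :
  [pchar K] =i pred0 ->
  (forall jk, indexI n jk -> exists p q : 'rV[K]_n * 'rV[K]_n,
     forall jk', indexI n jk' ->
       (bimoment (points p) jk'.1 jk'.2 == bimoment (points q) jk'.1 jk'.2)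
       = (jk' != jk)) ->
  minimal_separating (@setS K n).
Proof.
move=> charK0 wit; split=> [|T [TS [_ [jk jkI ->] notT]] [_ sepT]].
  exact: setS_separating.
have [p [q pq]] := wit jk jkI.
case: (sepT p q) => [|g Tg].
  exists (fpoly K n jk.1 jk.2); first exact: fpoly_invariant.
  by rewrite !evalV2_fpoly; apply/eqP; rewrite pq // eqxx.
case: (TS g Tg) => jk' jk'I eq_g; rewrite eq_g !evalV2_fpoly; apply; apply/eqP.
rewrite pq //; apply: contra_notN notT => /eqP eq_jk.
by rewrite -eq_jk -eq_g.
Qed.

(** Pairs of lists of n integers whose power sums of exponents 1, ..., n agree
    except for exponent k.  When all other nonzero power sums have even exponent, a
    list and its opposite will do: for (n,k) = (4,1) this uses
    3^3 + 4^3 + 5^3 = 6^3.  For (4,4) both lists are symmetric about 0, which kills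
    the odd power sums, and 2 * 5^2 = 2 * (3^2 + 4^2).  The pairs for (3,1) and
    (4,2) are sporadic numerical solutions. *)
Definition power_sum_pair (n k : nat) : seq Z * seq Z :=
  match n, k with
  | 1%N, _ => ([:: 1], [:: -1])
  | 2%N, 1%N => ([:: 1; 1], [:: -1; -1])
  | 2%N, _ => ([:: 0; 0], [:: 1; -1])
  | 3%N, 1%N => ([:: -3; -5; -8], [:: 1; 4; -9])
  | 3%N, 2%N => ([:: 1; 1; -1], [:: 1; 0; 0])
  | 3%N, _ => ([:: 1; 1; -2], [:: -1; -1; 2])
  | 4%N, 1%N => ([:: 3; 4; 5; -6], [:: -3; -4; -5; 6])
  | 4%N, 2%N => ([:: 6; 7; -11; -16], [:: 2; 4; -3; -17])
  | 4%N, 3%N => ([:: 1; 1; -2; 0], [:: -1; -1; 2; 0])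
  | _, _ => ([:: 5; -5; 0; 0], [:: 3; -3; 4; -4])
  end.

(** Two points with the same x on which, among the moments indexed by I, only the
    one of bidegree (j,k) differs, for j, k > 0.  In most cases the second y is
    the opposite of the first, and the same multiset: the moments with k = 0 or
    k = 2 and all pure power sums of y then agree automatically, and y only has to
    be orthogonal to the powers x^i with 0 < i < n and i <> j, but not to x^j.
    For (n,j,k) = (3,2,1), y - y' = (1,-2,1) is orthogonal to 1 and x but not to
    x^2, and y' is a permutation of y.  For (4,1,2), x takes two values and the
    two fibers {1,-1} and {0,0} of y, which have the same sum, are exchanged. *)
Definition mixed_pair (n j k : nat) :
    seq (Z * Z) * seq (Z * Z) :=
  let pair x y y' := (zip x y, zip x y') in
  match n, j, k with
  | 2%N, _, _ => pair [:: 1; -1] [:: 1; -1] [:: -1; 1]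
  | 3%N, 1%N, _ => pair [:: 1; -1; 0] [:: 1; -1; 0] [:: -1; 1; 0]
  | 3%N, _, _ => pair [:: 1; 0; -1] [:: 1; 0; 2] [:: 0; 2; 1]
  | _, 1%N, 1%N => pair [:: 1; -1; 2; -2] [:: 8; -8; -1; 1] [:: -8; 8; 1; -1]
  | _, 1%N, _ => pair [:: 1; 1; 0; 0] [:: 1; -1; 0; 0] [:: 0; 0; 1; -1]
  | _, 2%N, _ => pair [:: 0; 1; 1; -1] [:: 2; -2; 1; -1] [:: -2; 2; -1; 1]
  | _, _, _ => pair [:: 1; -1; 2; -2] [:: 2; -2; -1; 1] [:: -2; 2; 1; -1]
  end.

Definition witness (n : nat) (jk : nat * nat) :
    seq (Z * Z) * seq (Z * Z) :=
  let: (j, k) := jk in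
  if j == 0%N then let: (u, v) := power_sum_pair n k in
    ([seq (0, a) | a <- u], [seq (0, a) | a <- v])
  else if k == 0%N then let: (u, v) := power_sum_pair n j in
    ([seq (a, 0) | a <- u], [seq (a, 0) | a <- v])
  else mixed_pair n j k.

(** Big operators are locked, so computations go through this plain recursion. *)
Lemma bimomentE (R : pzSemiRingType) (s : seq (R * R)) (j k : nat) :
  bimoment s j k = foldr (fun z m => z.1 ^+ j * z.2 ^+ k + m) 0 s.
Proof. by rewrite /bimoment unlock. Qed.

Lemma witnessP (n : nat) (jk : nat * nat) :
  (1 <= n <= 4)%N -> indexI n jk ->
  [/\ size (witness n jk).1 = n, size (witness n jk).2 = n &
    forall jk', indexI n jk' ->
      (bimoment (witness n jk).1 jk'.1 jk'.2 ==
       bimoment (witness n jk).2 jk'.1 jk'.2) = (jk' != jk)].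
Proof.
pose moment (s : seq (Z * Z)) (jk : nat * nat) :=
  foldr (fun z m => z.1 ^+ jk.1 * z.2 ^+ jk.2 + m) 0 s.
pose I n := [seq jk <- [seq (j, k) | j <- iota 0 n.+1, k <- iota 0 n.+1]
  | indexI n jk].
have checked : all (fun n => all (fun jk =>
     let w := witness n jk in
     [&& size w.1 == n, size w.2 == n &
       all (fun jk' => (moment w.1 jk' == moment w.2 jk') == (jk' != jk))
         (I n)])
    (I n)) (iota 1 4).
  by vm_compute.
move=> n_bd jkI; have memI jk' : indexI n jk' -> jk' \in I n.
  by move=> jk'I; rewrite mem_filter jk'I indexI_mem.
have n_in : n \in iota 1 4 by rewrite mem_iota add1n ltnS.
have /allP/(_ jk (memI _ jkI)) := allP checked n n_in.
case/and3P=> /eqP sz1 /eqP sz2 /allP eqw.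
by split=> // jk' /memI/eqw/eqP; rewrite !bimomentE.
Qed.

Definition of_Z (R : pzRingType) (z : Z) : R := (int_of_Z z)%:~R.

Lemma of_Z_inj (K : fieldType) : [pchar K] =i pred0 -> injective (@of_Z K).
Proof.
move=> /pcharf0P charK0 u v eq_uv; apply/(can_inj int_of_ZK)/subr0_eq/eqP.
have : (int_of_Z u - int_of_Z v)%:~R == 0 :> K.
  by rewrite rmorphB subr_eq0 /= -/(of_Z K u) eq_uv.
case: (_ - _) => m; first by rewrite -[_%:~R]/(m%:R) charK0.
by rewrite -[_%:~R]/(- m.+1%:R) oppr_eq0 charK0.
Qed.

Definition point_of (K : fieldType) (n : nat) (s : seq (Z * Z)) :
    'rV[K]_n * 'rV[K]_n :=
  (\row_i of_Z K (nth (0, 0) s i).1, \row_i of_Z K (nth (0, 0) s i).2).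

Lemma bimoment_point_of (K : fieldType) (n j k : nat) (s : seq (Z * Z)) :
  size s = n ->
  bimoment (points (point_of K n s)) j k = of_Z K (bimoment s j k).
Proof.
move=> sz_s; rewrite /of_Z /bimoment !rmorph_sum big_tuple.
rewrite (big_nth (0, 0)) big_mkord sz_s.
by apply: eq_bigr => i _; rewrite tnth_mktuple /= !mxE !rmorphM !rmorphXn.
Qed.

Theorem theorem2 (K : fieldType) (charK0 : [pchar K] =i pred0)
    (n : nat) (hn : (1 <= n <= 4)%N) :
  minimal_separating (@setS K n).
Proof.
apply: minimal_separatingP => // jk jkI.
have [sz1 sz2 eqw] := witnessP hn jkI.
exists (point_of K n (witness n jk).1), (point_of K n (witness n jk).2).
move=> jk' jk'I.
by rewrite !bimoment_point_of // (inj_eq (of_Z_inj charK0)) eqw.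
Qed.
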